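(* Let $p$ be a prime, $N=p^e$ with $e\ge1$, let $h\ge1$ be a divisor of $N-1$, put $A=(N-1)/h$ and $\Lambda_{N,h}(U)=U(U^A-1)^h\in\mathbb F_p[U]$. Let $Q=p^m$ with $m\ge1$ and put $s=p^{\gcd(e,m)}$, $C=(N-1)/(s-1)$, $\kappa=\gcd(h,C)$. For $t\in\mathbb F_Q$ let $r_Q(t)=\#\{u\in\mathbb F_Q:\Lambda_{N,h}(u)=t\}$, and define the fibre enumerator $\mathcal E_{N,h,Q}(Z)=\sum_{t\in\mathbb F_Q}Z^{r_Q(t)}$. Put $$M_0(Q)=\frac{\kappa(s-1)Q}{hs},\qquad M_1(Q)=\frac{(h-\kappa)(Q-1)}{h},\qquad M_s(Q)=\frac{\kappa(Q-s)}{hs}.$$ Then $$\mathcal E_{N,h,Q}(Z)=Z^{1+\kappa(s-1)/h}+M_0(Q)+M_1(Q)Z+M_s(Q)Z^s.$$ Consequently $$\#\Lambda_{N,h}(\mathbb F_Q)=Q-M_0(Q)=Q\left(1-\frac{\kappa(s-1)}{hs}\right),$$ and for every fixed integer $a\ge1$, $$\sum_{t\in\mathbb F_Q}r_Q(t)^a=\left(1+\frac{\kappa(s-1)}h\right)^a+\frac{(h-\kappa)(Q-1)}h+s^{a-1}\,\frac{\kappa(Q-s)}h.$$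
   Context: Fibres are counted as sets of $\mathbb F_Q$-rational points, without multiplicity. $\Lambda_{N,h}(\mathbb F_Q)$ denotes the value set (image) of $u\mapsto\Lambda_{N,h}(u)$ on $\mathbb F_Q$. The number $C$ is an integer because $s-1\mid N-1$. *)

(* Defs.v *)
From HB Require Import structures.
From mathcomp Require Import all_boot all_order all_algebra all_field.

Set Implicit Arguments.
Unset Strict Implicit.
Unset Printing Implicit Defensive.

Import GRing.Theory.
Local Open Scope ring_scope.

(* Over an arbitrary commutative ring R; the coefficients are integers, so for
   a field F of characteristic p the value at F is the image of the polynomial
   over 'F_p, see map_Lambda. *)
Definition Lambda (R : comNzRingType) (N h : nat) : {poly R} :=
  'X * ('X^((N - 1) %/ h) - 1) ^+ h.

Lemma map_Lambda (R S : comNzRingType) (f : {rmorphism R -> S}) (N h : nat) :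
  map_poly f (Lambda R N h) = Lambda S N h.
Proof.
by rewrite rmorphM rmorphXn rmorphB rmorph1 /= map_polyXn map_polyX.
Qed.

Definition fibre_card (F : finFieldType) (N h : nat) (t : F) : nat :=
  #|[set u : F | (Lambda F N h).[u] == t]|.

Definition value_set (F : finFieldType) (N h : nat) : {set F} :=
  [set (Lambda F N h).[u] | u : F].

(* The enumerator has rational coefficients because the closed form for it is
   written with fractions. *)
Definition fibre_enumerator (F : finFieldType) (N h : nat) : {poly rat} :=
  \sum_(t : F) 'X^(fibre_card N h t).

Definition M_zero (h kappa s Q : nat) : rat :=
  kappa%:R * (s%:R - 1) * Q%:R / (h%:R * s%:R).

Definition M_one (h kappa Q : nat) : rat :=
  (h%:R - kappa%:R) * (Q%:R - 1) / h%:R.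

Definition M_s (h kappa s Q : nat) : rat :=
  kappa%:R * (Q%:R - s%:R) / (h%:R * s%:R).

(* Main.v *)
(* Over an extension containing enough roots of unity, the substitution u = w^h
   turns Lambda into the h-th power of the additive polynomial L(w) = w^N - w.
   If t = y^h is a nonzero element of the field F of Q elements, then
   eta = y^(Q-1) is an h-th root of unity and w |-> w^h is a bijection from the
   solutions of L(w) = y in W = {w | w^Q = eta w} to the fibre of t.  Now W has
   Q elements and is stable under L, and the kernel of L on W has s elements if
   eta^C = 1 and is trivial otherwise, so the sizes of the fibres over W are
   known.  Finally y |-> y^h is h-to-1 onto the nonzero elements of F, and
   exactly kappa of the h-th roots of unity eta satisfy eta^C = 1. *)
Require Import Defs.
From HB Require Import structures.
From mathcomp Require Import all_boot all_order all_algebra all_solvable all_field.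
From mathcomp Require Import ring.

Set Implicit Arguments.
Unset Strict Implicit.
Unset Printing Implicit Defensive.

Import GRing.Theory.
Local Open Scope ring_scope.

(** * Powers, roots of unity and fibres of additive maps *)

(** Euclid's algorithm runs on the exponents, since p^b - 1 = p^(b-a) (p^a - 1) + (p^(b-a) - 1). *)
Lemma gcdn_expn_sub1 p a b : (0 < p)%N ->
  gcdn (p ^ a - 1) (p ^ b - 1) = (p ^ gcdn a b - 1)%N.
Proof.
move=> p_gt0; have [n] := ubnP (a + b); elim: n a b => // n IHn a b.
wlog le_ab : a b / (a <= b)%N => [hw|].
  by case: (leqP a b) => [|/ltnW] /hw // IH;
     rewrite addnC gcdnC (gcdnC a); apply: IH.
case: (posnP a) => [->|a_gt0]; first by rewrite expn0 subnn !gcd0n.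
rewrite ltnS => le_n.
have -> : (p ^ b - 1 = p ^ (b - a) * (p ^ a - 1) + (p ^ (b - a) - 1))%N.
  rewrite mulnBr muln1 -expnD subnK // addnBA ?expn_gt0 ?p_gt0 //.
  by rewrite subnK // leq_pexp2l ?leq_subr.
rewrite gcdnMDl IHn; last first.
  by rewrite subnKC //; apply: leq_trans le_n; rewrite -[X in (X < _)%N]add0n ltn_add2r.
by rewrite -{2}(subnK le_ab) gcdnDr.
Qed.

(** In a splitting field of X^n - 1, separable because n is invertible, the n distinct roots include
    a primitive one. *)
Lemma finField_ext_prim_root (F : finFieldType) (n : nat) :
  n%:R != 0 :> F ->
  exists (E : finFieldType) (f : {rmorphism F -> E}) (z : E), n.-primitive_root z.
Proof.
move=> nz_n; have n_gt0 : (0 < n)%N by case: n nz_n => //; rewrite eqxx.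
have /FinSplittingFieldFor[/= L [zs Dp _]] : 'X^n - 1 != 0 :> {poly F}.
  by rewrite monic_neq0 ?monicXnsubC.
rewrite rmorphB rmorph1 /= map_polyXn in Dp.
exists (FinFieldExtType L), (in_alg L : {rmorphism F -> L}).
have Uzs : uniq zs.
  rewrite -separable_prod_XsubC -(eqp_separable Dp) cyclotomic.separable_Xn_sub_1 //.
  by rewrite -(rmorph_nat (in_alg L)) fmorph_eq0.
have szs : (n <= size zs)%N.
  by rewrite -ltnS -(size_prod_XsubC _ id) -(eqp_size Dp) size_XnsubC.
have rts : all n.-unity_root zs.
  apply/allP=> z; rewrite -root_prod_XsubC -(eqp_root Dp) rootE !hornerE subr_eq0.
  by rewrite unity_rootE.
by have /hasP[z _ prim_z] := has_prim_root n_gt0 rts Uzs szs; exists z.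
Qed.

(** Each nonempty fibre of [L] on the group [D] is a coset of the kernel, so [#|D| %/ k] values have
    [k] preimages and the others have none. *)
Lemma sum_fibres_additive (E : finZmodType) (D : {set E}) (L : E -> E)
    (V : nmodType) (G : nat -> V) (k := #|[set w in D | L w == 0]|) :
    0 \in D -> {in D &, forall x y, x - y \in D} -> {in D, forall x, L x \in D} ->
    {morph L : x y / x - y} ->
  (k * (#|D| %/ k) = #|D|)%N /\
  \sum_(y in D) G #|[set w in D | L w == y]|
    = G k *+ (#|D| %/ k) + G 0%N *+ (#|D| - #|D| %/ k).
Proof.
move=> D0 DB DL LB.
have DD x y : x \in D -> y \in D -> x + y \in D.
  by move=> Dx Dy; rewrite -[y]opprK DB // -[- y]sub0r DB //.
have L0 : L 0 = 0 by rewrite -[X in L X](subrr 0) LB subrr.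
have LD x y : L (x + y) = L x + L y.
  by rewrite -{1}[y]opprK LB -[- y]sub0r LB L0 sub0r opprK.
have fibE y : y \in L @: D -> #|[set w in D | L w == y]| = k.
  case/imsetP=> w0 Dw0 ->; rewrite /k -[RHS](card_imset _ (addrI w0)).
  apply: eq_card => w; rewrite inE; apply/andP/imsetP => [[Dw /eqP Lw] | [d]].
    exists (w - w0); last by rewrite addrC subrK.
    by rewrite inE DB //= LB Lw subrr.
  by rewrite inE => /andP[Dd /eqP Ld] ->; rewrite DD // LD Ld addr0.
have sLD : L @: D \subset D by apply/subsetP=> _ /imsetP[w /DL ? ->].
have k_gt0 : (0 < k)%N by apply/card_gt0P; exists 0; rewrite inE D0 L0 eqxx.
have cD : #|D| = (#|L @: D| * k)%N.
  rewrite -sum1_card (partition_big_imset L) /= -sum_nat_const.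
  apply: eq_bigr => y /fibE <-; rewrite -sum1_card; apply: eq_bigl => w.
  by rewrite inE.
have cI : (#|D| %/ k = #|L @: D|)%N by rewrite cD mulnK.
split; first by rewrite cI cD mulnC.
rewrite cI (big_setID (L @: D)) /=; congr (_ + _).
  rewrite (setIidPr sLD) -sumr_const; apply: eq_bigr => y /fibE -> //.
have -> : (#|D| - #|L @: D| = #|D :\: L @: D|)%N by rewrite cardsD (setIidPr sLD).
rewrite -sumr_const; apply: eq_bigr => y /setDP[_ Ly].
congr G; apply: eq_card0 => w; rewrite inE; apply/andP=> -[Dw /eqP Lw].
by case/negP: Ly; rewrite -Lw imset_f.
Qed.

(** If x = z^i, then x^a = 1 forces ab to divide ia, hence b to divide i. *)
Lemma prim_root_radical (F : fieldType) (a b : nat) (z x : F) :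
  (a * b).-primitive_root z -> x ^+ a = 1 -> exists y, y ^+ b = x.
Proof.
move=> prim_z xa1; have := prim_order_gt0 prim_z; rewrite muln_gt0 => /andP[a_gt0 _].
have [|i Dx] := prim_rootP prim_z (x := x); first by rewrite exprM xa1 expr1n.
have : (a * b %| i * a)%N by rewrite (prim_order_dvd prim_z) exprM -Dx xa1.
rewrite [X in (_ %| X)%N]mulnC dvdn_pmul2l // => /dvdnP[j Di].
by exists (z ^+ j); rewrite -exprM -Di.
Qed.

Lemma card_unity_roots (E : finFieldType) (n d : nat) (z : E) :
  n.-primitive_root z -> (d %| n)%N -> #|[set x : E | x ^+ d == 1]| = d.
Proof.
move=> /dvdn_prim_root prim_z /prim_z{prim_z}; set w := z ^+ _ => prim_w.
have inj_w : injective (fun i : 'I_d => w ^+ i).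
  move=> i j /eqP; rewrite (eq_prim_root_expr prim_w) !modn_small // => /eqP.
  exact: val_inj.
rewrite -[RHS]card_ord -(card_imset _ inj_w); apply: eq_card => x; rewrite inE.
apply/eqP/imsetP => [/(prim_rootP prim_w)[i ->] | [i _ ->]]; first by exists i.
by rewrite exprAC (prim_expr_order prim_w) expr1n.
Qed.

Lemma expf_eq_scale (F : fieldType) (q : nat) (c x : F) :
  (0 < q)%N -> (x ^+ q == c * x) = (x == 0) || (x ^+ (q - 1) == c).
Proof.
move=> q_gt0; rewrite -{1}(subnK q_gt0) addn1 exprSr.
have [->|nz_x] := eqVneq x 0; first by rewrite !mulr0 eqxx.
by rewrite (inj_eq (mulIf nz_x)).
Qed.

Lemma expf_eq_id (F : fieldType) (q : nat) (x : F) :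
  (0 < q)%N -> (x ^+ q == x) = (x == 0) || (x ^+ (q - 1) == 1).
Proof. by move=> q_gt0; rewrite -(expf_eq_scale 1) // mul1r. Qed.

Lemma card_expf_id (E : finFieldType) (n q : nat) (z : E) :
  n.-primitive_root z -> (0 < q)%N -> (q - 1 %| n)%N ->
  #|[set x : E | x ^+ q == x]| = q.
Proof.
move=> prim_z q_gt0 dv_n.
have -> : [set x : E | x ^+ q == x] = 0 |: [set x | x ^+ (q - 1) == 1].
  by apply/setP=> x; rewrite !inE expf_eq_id.
rewrite cardsU1 (card_unity_roots prim_z) // inE expr0n.
have : (0 < q - 1)%N := dvdn_gt0 (prim_order_gt0 prim_z) dv_n.
by case: (q - 1)%N (subnK q_gt0) => //= k <- _; rewrite eq_sym oner_eq0 addnC.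
Qed.

Lemma expf_gcd_eq1 (F : fieldType) (a b : nat) (x : F) :
  (x ^+ gcdn a b == 1) = (x ^+ a == 1) && (x ^+ b == 1).
Proof.
apply/eqP/andP=> [x1 | [/eqP xa /eqP xb]].
  have x1d d : (gcdn a b %| d)%N -> x ^+ d == 1.
    by case/dvdnP=> k ->; rewrite mulnC exprM x1 expr1n.
  by split; apply: x1d; rewrite (dvdn_gcdl, dvdn_gcdr).
case: (posnP a) => [->|a_gt0]; first by rewrite gcd0n.
case: (egcdnP b a_gt0) => ka kb + _ => /(congr1 (GRing.exp x)).
by rewrite exprD !(mulnC _ a) !(mulnC _ b) !exprM xa xb !expr1n mul1r.
Qed.

(** Multiplication by [w] carries the fixed points of the q-th power map onto a twisted space, which
    reduces counting the latter to counting the former. *)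
Lemma expf_scale_twist (F : fieldType) (q : nat) (w x : F) :
  w != 0 -> (0 < q)%N -> ((w * x) ^+ q == w ^+ (q - 1) * (w * x)) = (x ^+ q == x).
Proof.
move=> nz_w q_gt0; rewrite mulrA -exprSr subn1 prednK // exprMn.
by rewrite (inj_eq (mulfI _)) ?expf_neq0.
Qed.

(** * Eigenspaces of Frobenius and the additive polynomial L *)

Section TwistedFrobenius.

Variables (p e m h : nat) (F E : finFieldType) (f : {rmorphism F -> E}) (z : E).
Let N := (p ^ e)%N.
Let Q := (p ^ m)%N.
Let s := (p ^ gcdn e m)%N.
Let C := ((N - 1) %/ (s - 1))%N.
Hypotheses (p_pr : prime p) (e_gt0 : (0 < e)%N) (m_gt0 : (0 < m)%N).
Hypotheses (h_gt0 : (0 < h)%N) (dv_h : (h %| N - 1)%N) (cardF : #|F| = Q).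
(** With this product as order, (N-1)-th roots of unity have (Q-1)-th roots in [E], and
    conversely. *)
Hypothesis prim_z : ((N - 1) * (Q - 1)).-primitive_root z.

Let L (w : E) : E := w ^+ N - w.
Definition twisted_space (q : nat) (eta : E) : {set E} := [set w | w ^+ q == eta * w].
Let W := twisted_space Q.

Let pow_gt1 k : (0 < k)%N -> (1 < p ^ k)%N.
Proof. by move=> k_gt0; rewrite -(expn0 p) ltn_exp2l ?prime_gt1. Qed.

Let N_gt1 : (1 < N)%N. Proof. exact: pow_gt1. Qed.
Let Q_gt1 : (1 < Q)%N. Proof. exact: pow_gt1. Qed.
Let s_gt1 : (1 < s)%N. Proof. by rewrite pow_gt1 // gcdn_gt0 e_gt0. Qed.
Let N_gt0 : (0 < N)%N. Proof. exact: ltnW. Qed.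
Let Q_gt0 : (0 < Q)%N. Proof. exact: ltnW. Qed.
Let s_gt0 : (0 < s)%N. Proof. exact: ltnW. Qed.
Let N1_gt0 : (0 < N - 1)%N. Proof. by rewrite subn_gt0. Qed.
Let Q1_gt0 : (0 < Q - 1)%N. Proof. by rewrite subn_gt0. Qed.

Let gcdNQ : gcdn (N - 1) (Q - 1) = (s - 1)%N.
Proof. by rewrite gcdn_expn_sub1 ?prime_gt0. Qed.

Let dv_sN : (s - 1 %| N - 1)%N. Proof. by rewrite -gcdNQ dvdn_gcdl. Qed.
Let dv_sQ : (s - 1 %| Q - 1)%N. Proof. by rewrite -gcdNQ dvdn_gcdr. Qed.

Let pcharE : p \in [pchar E].
Proof. by have := card_finPcharP cardF p_pr; rewrite -(fmorph_pchar f). Qed.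

Let exprDp k (x y : E) : (x + y) ^+ (p ^ k) = x ^+ (p ^ k) + y ^+ (p ^ k).
Proof. by rewrite exprDn_pchar // pnatX pnatE // pcharE. Qed.

Let exprBp k (x y : E) : (x - y) ^+ (p ^ k) = x ^+ (p ^ k) - y ^+ (p ^ k).
Proof. by apply/eqP; rewrite eq_sym subr_eq -exprDp subrK. Qed.

Let LB : {morph L : x y / x - y}.
Proof. by move=> x y; rewrite /L exprBp !opprD addrACA. Qed.

(** Since h divides N-1, scaling by an h-th root of unity commutes with [L]. *)
Let root_h_N (c : E) : c ^+ h = 1 -> c ^+ N = c.
Proof.
move=> c_h; apply/eqP; rewrite expf_eq_id // -(divnK dv_h) mulnC exprM c_h expr1n.
by rewrite eqxx orbT.
Qed.

Let L_twisted eta : eta ^+ h = 1 -> {in W eta, forall w, L w \in W eta}.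
Proof.
move=> eta_h w; rewrite !inE => /eqP Dw; apply/eqP.
by rewrite /L exprBp exprAC Dw exprMn (root_h_N eta_h) mulrBr.
Qed.

(** As eta^(N-1) = 1, eta is some w0^(Q-1), and [W eta] is w0 times the field of Q elements. *)
Let card_twisted eta : eta ^+ h = 1 -> #|W eta| = Q.
Proof.
move=> eta_h; have eta_N1 : eta ^+ (N - 1) = 1.
  by rewrite -(divnK dv_h) mulnC exprM eta_h expr1n.
have [w0 Dw0] := prim_root_radical prim_z eta_N1.
have nz_eta : eta != 0.
  by apply: contra_eq_neq eta_h => ->; rewrite expr0n gtn_eqF // eq_sym oner_neq0.
have nz_w0 : w0 != 0.
  by apply: contraNneq nz_eta => w00; rewrite -Dw0 w00 expr0n gtn_eqF.
rewrite -[RHS](card_expf_id prim_z Q_gt0 (dvdn_mull _ (dvdnn _))).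
rewrite -(card_preimset _ (mulfI nz_w0)); apply: eq_card => x.
by rewrite !inE -Dw0 expf_scale_twist.
Qed.

(** A nonzero kernel element w has w^(N-1) = 1 and w^(Q-1) = eta, so eta^C = 1 because N-1 divides
    C(Q-1). Conversely, if eta^C = 1, the kernel is a multiple of the field of s elements. *)
Let card_kernel eta : eta ^+ h = 1 ->
  #|[set w in W eta | L w == 0]| = if eta ^+ C == 1 then s else 1%N.
Proof.
move=> eta_h; have nz_eta : eta != 0.
  by apply: contra_eq_neq eta_h => ->; rewrite expr0n gtn_eqF // eq_sym oner_neq0.
have NC : (N - 1 = C * (s - 1))%N by rewrite divnK.
case: eqP => [eta_C | /eqP eta_C]; last first.
  apply/eqP/cards1P; exists 0; apply/setP=> w; rewrite !inE subr_eq0.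
  apply/andP/eqP => [[Qw Nw] | ->]; last by rewrite !expr0n !gtn_eqF // mulr0 eqxx.
  apply: contraNeq eta_C => nz_w; move: Qw Nw.
  rewrite expf_eq_scale // expf_eq_id // (negPf nz_w) /= => /eqP<- /eqP w1.
  by rewrite -exprM -(divnK dv_sQ) -mulnA [(_ * C)%N]mulnC -NC mulnC exprM w1 expr1n.
have [d dQ dN] : exists2 d : E, d ^+ (Q - 1) = eta & d ^+ (N - 1) = 1.
  (* Here z^(Q-1) has order N-1 = C(s-1), so eta^C = 1 yields an (s-1)-th root [d0] of eta, and
     d0^(N-1) = 1. *)
  have prim_z' : (C * (s - 1)).-primitive_root (z ^+ (Q - 1)).
    rewrite -NC -[X in z ^+ X](mulKn _ N1_gt0).
    exact: dvdn_prim_root (dvdn_mulr _ (dvdnn _)).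
  have [d0 Dd0] := prim_root_radical prim_z' eta_C.
  have d0N : d0 ^+ (N - 1) = 1 by rewrite NC mulnC exprM Dd0.
  (* d is d0 to the Bezout coefficient of Q - 1 in gcd(Q-1, N-1) = s-1. *)
  case: (egcdnP (N - 1) Q1_gt0) => ka kb + _ => /(congr1 (GRing.exp d0)).
  rewrite gcdnC gcdNQ exprD ![(_ * (_ - 1))%N]mulnC (exprM _ (N - 1)) d0N expr1n.
  rewrite mul1r Dd0 => Dka.
  by exists (d0 ^+ ka); [rewrite -exprM mulnC | rewrite exprAC d0N expr1n].
have nz_d : d != 0.
  by apply: contraNneq nz_eta => d0; rewrite -dQ d0 expr0n gtn_eqF.
rewrite -[RHS](card_expf_id prim_z s_gt0 (dvdn_mulr _ dv_sN)).
rewrite -(card_preimset _ (mulfI nz_d)); apply: eq_card => x.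
rewrite !inE -dQ expf_scale_twist // subr_eq0.
(* Reading 1 as d^(N-1) puts the kernel equation in twisted form too; cancelling d leaves x^Q = x
   and x^N = x. *)
rewrite -[X in _ && (_ == X)]mul1r -dN expf_scale_twist //.
rewrite !expf_eq_id //.
by rewrite -gcdNQ expf_gcd_eq1 -orb_andr andbC.
Qed.

(** The value 0 is left out because it lies in every [W eta], while a nonzero y lies in only one.
    Its fibre is the kernel, so one fibre of kernel size is removed. *)
Let sum_twisted (V : zmodType) (G : nat -> V) eta : eta ^+ h = 1 ->
  \sum_(y in W eta | y != 0) G #|[set w in W eta | L w == y]|
    = if eta ^+ C == 1
      then G s *+ (Q %/ s - 1) + G 0%N *+ (Q - Q %/ s) else G 1%N *+ (Q - 1).
Proof.
move=> eta_h; have cW := card_twisted eta_h.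
have W0 : 0 \in W eta by rewrite inE mulr0 expr0n gtn_eqF.
have WB : {in W eta &, forall x y, x - y \in W eta}.
  by move=> x y; rewrite !inE exprBp mulrBr => /eqP-> /eqP->.
have [dvk] := sum_fibres_additive G W0 WB (L_twisted eta_h) LB.
rewrite (bigD1 0) //= !cW card_kernel // in dvk *; set k := if _ then _ else _ in dvk *.
have q_gt0 : (0 < Q %/ k)%N by move: Q_gt0; rewrite -{1}dvk muln_gt0 => /andP[].
rewrite -{1}(subnK q_gt0) addn1 mulrS -addrA => /addrI ->.
by rewrite /k; case: ifP; rewrite ?divn1 ?subnn ?mulr0n ?addr0.
Qed.

(** * Fibres of Lambda over nonzero values *)

Let LambdaE (u : F) :
  f (Lambda F N h).[u] = f u * (f u ^+ ((N - 1) %/ h) - 1) ^+ h.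
Proof. by rewrite /Lambda !hornerE rmorphM rmorphXn rmorphB rmorph1 rmorphXn. Qed.

Let Lambda_pow (u : F) (w : E) : f u = w ^+ h -> f (Lambda F N h).[u] = L w ^+ h.
Proof.
move=> Du; rewrite LambdaE Du -exprM mulnC divnK // -exprMn mulrBr mulr1 -exprS.
by rewrite subn1 prednK.
Qed.

(** The image of [f] consists of Q solutions of x^Q = x, and there are only Q. *)
Let f_range x : x ^+ Q = x -> exists u, f u = x.
Proof.
move=> Qx; suff: x \in [set f u | u : F] by case/imsetP=> u _ ->; exists u.
have -> : [set f u | u : F] = [set x | x ^+ Q == x]; last by rewrite inE Qx.
apply/eqP; rewrite eqEcard (card_expf_id prim_z Q_gt0 (dvdn_mull _ (dvdnn _))).
rewrite card_imset ?cardF ?leqnn ?andbT; last exact: fmorph_inj.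
by apply/subsetP=> _ /imsetP[u _ ->]; rewrite inE -rmorphXn -cardF expf_card.
Qed.

Let root_h (x : E) : x ^+ (Q - 1) = 1 -> exists w : E, w ^+ h = x.
Proof.
move: prim_z; rewrite mulnC => prim_z' /(prim_root_radical prim_z')[w Dw].
by exists (w ^+ ((N - 1) %/ h)); rewrite -exprM divnK.
Qed.

Let f_unit (u : F) : u != 0 -> f u ^+ (Q - 1) = 1.
Proof.
move=> nz_u; have: f u ^+ Q == f u by rewrite -rmorphXn -cardF expf_card.
by rewrite expf_eq_id // fmorph_eq0 (negPf nz_u) => /eqP.
Qed.

Let L_scale c w : c ^+ h = 1 -> L (c * w) = c * L w.
Proof. by move=> c_h; rewrite /L exprMn (root_h_N c_h) mulrBr. Qed.

Let fibre_twisted (t : F) (y : E) : t != 0 -> f t = y ^+ h ->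
  fibre_card N h t = #|[set w in W (y ^+ (Q - 1)) | L w == y]|.
Proof.
move=> nz_t Dt; set eta := y ^+ (Q - 1); set B := [set w in _ | _].
have nz_y : y != 0.
  by apply: contraNneq nz_t => y0; rewrite -(fmorph_eq0 f) Dt y0 expr0n gtn_eqF.
have eta_h : eta ^+ h = 1 by rewrite exprAC -Dt f_unit.
(* Two solutions with equal h-th powers differ by an h-th root of unity c, and L(cw) = c L(w) forces
   c = 1. *)
have inj_h : {in B &, injective (fun w => w ^+ h)}.
  move=> w1 w2; rewrite !inE => /andP[_ /eqP Lw1] /andP[_ /eqP Lw2] eq_h.
  have nz_w2 : w2 != 0.
    by apply: contraNneq nz_y => w20; rewrite -Lw2 w20 /L expr0n gtn_eqF // subr0.
  have Dw1 : w1 = w1 / w2 * w2 by rewrite divfK.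
  have c_h : (w1 / w2) ^+ h = 1 by rewrite expr_div_n eq_h divff // expf_neq0.
  have: w1 / w2 * y = 1 * y by rewrite -{1}Lw2 -L_scale // -Dw1 Lw1 mul1r.
  by move/(mulIf nz_y) => c1; rewrite Dw1 c1 mul1r.
rewrite -(card_in_imset inj_h) /fibre_card -(card_imset _ (fmorph_inj f)).
apply: eq_card => x; apply/imsetP/imsetP => [[u] | [w]]; rewrite !inE.
  move=> /eqP Du ->{x}; have nz_u : u != 0.
    by apply: contraNneq nz_t => u0; rewrite -Du u0 /Lambda !hornerE.
  have [w1 Dw1] := root_h (f_unit nz_u).
  have Lw1h : L w1 ^+ h = y ^+ h by rewrite -(Lambda_pow (esym Dw1)) Du.
  have nz_Lw1 : L w1 != 0 by have := expf_neq0 h nz_y; rewrite -Lw1h expf_eq0 h_gt0.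
  have c_h : (y / L w1) ^+ h = 1 by rewrite expr_div_n Lw1h divff // expf_neq0.
  (* Any h-th root w1 of [f u] gives L(w1) with the same h-th power as y; scaling by their ratio
     makes the value exactly y. *)
  set w := y / L w1 * w1; have Lw : L w = y by rewrite L_scale // divfK.
  have wh : w ^+ h = f u by rewrite exprMn c_h mul1r.
  exists w; rewrite // !inE Lw eqxx andbT expf_eq_scale //.
  have eta'_h : (w ^+ (Q - 1)) ^+ h = 1 by rewrite exprAC wh f_unit.
  (* L preserves the eigenspace of w, so w and the nonzero y = L(w) have the same eigenvalue. *)
  have: L w \in W (w ^+ (Q - 1)).
    by apply: L_twisted => //; rewrite inE expf_eq_scale // eqxx orbT.
  by rewrite Lw inE expf_eq_scale // (negPf nz_y) /= eq_sym => ->; rewrite orbT.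
case/andP=> /eqP Qw /eqP Lw ->.
have [|u Du] := f_range (x := w ^+ h); first by rewrite exprAC Qw exprMn eta_h mul1r.
exists u; rewrite ?inE //.
by rewrite -(inj_eq (fmorph_inj f)) (Lambda_pow Du) Lw Dt.
Qed.

Let card_unity_h : #|[set x : E | x ^+ h == 1]| = h.
Proof. by rewrite (card_unity_roots prim_z) // dvdn_mulr. Qed.

(* The weight G is arbitrary: Z^k, [k > 0] and k^a give the three formulas. *)
Lemma sum_nonzero_fibres (V : zmodType) (G : nat -> V) (kappa := gcdn h C) :
  (\sum_(t : F | t != 0) G (fibre_card N h t)) *+ h
  = (G s *+ (Q %/ s - 1) + G 0%N *+ (Q - Q %/ s)) *+ kappa
    + G 1%N *+ (Q - 1) *+ (h - kappa).
Proof.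
pose H y := G #|[set w in W (y ^+ (Q - 1)) | L w == y]|.
(* A nonzero t has h different h-th roots y, each giving the same fibre size. *)
have -> : (\sum_(t : F | t != 0) G (fibre_card N h t)) *+ h
          = \sum_(t : F | t != 0) \sum_(y : E | y ^+ h == f t) H y.
  rewrite -sumrMnl; apply: eq_bigr => t nz_t.
  have [y0 Dy0] := root_h (f_unit nz_t).
  have nz_y0 : y0 != 0.
    by apply: contraNneq nz_t => y00; rewrite -(fmorph_eq0 f) -Dy0 y00 expr0n gtn_eqF.
  have ch : #|[set y | y ^+ h == f t]| = h.
    rewrite -[RHS]card_unity_h -[LHS](card_preimset _ (mulfI nz_y0)).
    apply: eq_card => x; rewrite !inE exprMn Dy0 -{2}[f t]mulr1.
    by rewrite (inj_eq (mulfI _)) // fmorph_eq0.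
  rewrite -[X in _ *+ X]ch -sumr_const; apply: eq_big => [y | y]; rewrite inE // => /eqP Dy.
  by rewrite /H -(fibre_twisted nz_t).
(* After the exchange, each y for which y^(Q-1) is an h-th root of unity meets exactly one t, the
   preimage of y^h. *)
rewrite (exchange_big_dep (fun y : E => y ^+ (Q - 1) ^+ h == 1)) /=; last first.
  by move=> t y nz_t /eqP Dy; rewrite exprAC Dy f_unit.
transitivity (\sum_(y : E | y ^+ (Q - 1) ^+ h == 1) H y).
  apply: eq_bigr => y /eqP; rewrite exprAC => yh1.
  have [|t Dt] := f_range (x := y ^+ h).
    by apply/eqP; rewrite expf_eq_id // yh1 eqxx orbT.
  apply: big_pred1 => t'; rewrite -Dt (inj_eq (fmorph_inj f)) [t == t']eq_sym.
  apply: andb_idl => /eqP->.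
  apply: contra_eq_neq yh1 => t0.
  by rewrite -Dt t0 rmorph0 expr0n gtn_eqF // eq_sym oner_neq0.
rewrite (partition_big (fun y => y ^+ (Q - 1)) (fun eta => eta ^+ h == 1)) //=.
under eq_bigr => eta /eqP eta_h.
  under eq_bigl => y.
    have -> : (y ^+ (Q - 1) ^+ h == 1) && (y ^+ (Q - 1) == eta)
              = (y \in W eta) && (y != 0).
      rewrite inE expf_eq_scale //; have [->|nz_y] := eqVneq y 0.
        by rewrite andbF expr0n gtn_eqF // expr0n gtn_eqF // [0 == 1]eq_sym oner_eq0.
      by rewrite andbT /=; apply: andb_idl => /eqP->; rewrite eta_h.
  over.
  rewrite (eq_bigr (fun y => G #|[set w in W eta | L w == y]|)); last first.
    move=> y; rewrite inE expf_eq_scale // => /andP[/orP[/eqP-> /eqP//|/eqP yQ _]].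
    by rewrite /H yQ.
  rewrite sum_twisted //.
over.
(* The common roots of eta^h = 1 and eta^C = 1 are the kappa-th roots of unity. *)
rewrite (bigID (fun eta => eta ^+ C == 1)) /=.
set K := [set x : E | x ^+ kappa == 1].
have cK : #|K| = kappa.
  by rewrite (card_unity_roots prim_z) // dvdn_mulr // (dvdn_trans (dvdn_gcdl _ _)).
congr (_ + _).
  rewrite -cK -sumr_const; apply: eq_big => [x | x /andP[_ ->] //].
  by rewrite inE expf_gcd_eq1.
have -> : (h - kappa)%N = #|[set x : E | x ^+ h == 1] :\: K|.
  rewrite cardsD card_unity_h (setIidPr _) ?cK //.
  by apply/subsetP=> x; rewrite !inE expf_gcd_eq1 => /andP[].
rewrite -sumr_const; apply: eq_big => [x | x /andP[_ /negPf->] //].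
by rewrite !inE expf_gcd_eq1; case: (x ^+ h == 1); rewrite ?andbF ?andbT.
Qed.

(** * The fibre over zero *)

(** Since A = (N-1)/h divides N-1, gcd(A, Q-1) = gcd(A, s-1); multiplying by h gives gcd(N-1,
    h(s-1)). *)
Lemma gcdn_quotient (kappa := gcdn h C) :
  (gcdn ((N - 1) %/ h) (Q - 1) * h = kappa * (s - 1))%N.
Proof.
have -> : gcdn ((N - 1) %/ h) (Q - 1) = gcdn ((N - 1) %/ h) (s - 1).
  by rewrite -gcdNQ gcdnA (gcdn_idPl (dvdn_div dv_h)).
by rewrite !muln_gcdl divnK // gcdnC [(_ * h)%N]mulnC divnK.
Qed.

(** Besides 0, the zeros are the u in F with u^A = 1 and u^(Q-1) = 1, a group of order gcd(A,
    Q-1). *)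
Lemma zero_fibre (kappa := gcdn h C) :
  fibre_card N h (0 : F) = (1 + (kappa * (s - 1)) %/ h)%N.
Proof.
rewrite -gcdn_quotient mulnK //; set A := ((N - 1) %/ h)%N.
have A_gt0 : (0 < A)%N by rewrite divn_gt0 // dvdn_leq.
rewrite -(card_unity_roots prim_z (dvdn_mull _ (dvdn_gcdr A (Q - 1)))).
rewrite /fibre_card -(card_imset _ (fmorph_inj f)).
rewrite (cardsD1 0) (_ : 0 \in _); last first.
  by apply/imsetP; exists 0; rewrite ?rmorph0 // inE /Lambda !hornerE.
congr (_ + _)%N; apply: eq_card => x; rewrite !inE expf_gcd_eq1.
apply/andP/andP=> [[nz_x /imsetP[u]] | [xA xQ]].
  rewrite inE -(fmorph_eq0 f) LambdaE => Du Dx; move: nz_x Du; rewrite Dx => nz_u.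
  rewrite mulf_eq0 (negPf nz_u) expf_eq0 h_gt0 subr_eq0 /= => ->.
  by rewrite f_unit -?(fmorph_eq0 f).
have nz_x : x != 0.
  by apply: contraTneq xA => ->; rewrite expr0n gtn_eqF // eq_sym oner_neq0.
have [|u Du] := f_range (x := x); first by apply/eqP; rewrite expf_eq_id // xQ orbT.
split=> //; apply/imsetP; exists u => //.
by rewrite inE -(fmorph_eq0 f) LambdaE Du (eqP xA) subrr expr0n gtn_eqF // mulr0.
Qed.

End TwistedFrobenius.

(** * Rational coefficients and the closed formulas *)

(** Values in a rational vector space allow division by the factor h in [sum_nonzero_fibres]. *)
Lemma sum_fibres (p e h m : nat) (F : finFieldType) (V : lmodType rat) (G : nat -> V)
    (N := (p ^ e)%N) (Q := (p ^ m)%N) (s := (p ^ gcdn e m)%N)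
    (C := ((N - 1) %/ (s - 1))%N) (kappa := gcdn h C) :
  prime p -> (0 < e)%N -> (0 < h)%N -> (h %| N - 1)%N -> (0 < m)%N -> #|F| = Q ->
  (h %| kappa * (s - 1))%N /\
  \sum_(t : F) G (fibre_card N h t)
    = G (1 + (kappa * (s - 1)) %/ h)%N + M_zero h kappa s Q *: G 0%N
      + M_one h kappa Q *: G 1%N + M_s h kappa s Q *: G s.
Proof.
move=> p_pr e_gt0 h_gt0 dv_h m_gt0 cardF; have p_gt0 := prime_gt0 p_pr.
have pcharF := card_finPcharP cardF p_pr.
(* Both N-1 and Q-1 are -1 in [F], so their product is invertible and the extension [E] exists. *)
have powF k : (0 < k)%N -> (p ^ k - 1)%:R = -1 :> F.
  move=> k_gt0; rewrite natrB ?expn_gt0 ?p_gt0 // natrX (pcharf0 pcharF).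
  by rewrite expr0n gtn_eqF // sub0r.
have [|E [f [z prim_z]]] := @finField_ext_prim_root F ((N - 1) * (Q - 1)).
  by rewrite natrM !powF // mulrNN mulr1 oner_neq0.
split; first by rewrite -(gcdn_quotient m p_pr dv_h) dvdn_mull.
rewrite (bigD1 0) //= (zero_fibre f p_pr e_gt0 m_gt0 h_gt0 dv_h cardF prim_z) -!addrA.
congr (_ + _).
have := sum_nonzero_fibres f p_pr e_gt0 m_gt0 h_gt0 dv_h cardF prim_z G.
rewrite -/N -/Q -/s -/C -/kappa; move: (\sum_(t | _) _) => S.
have s_gt0 : (0 < s)%N by rewrite expn_gt0 p_gt0.
have Q_gt0 : (0 < Q)%N by rewrite expn_gt0 p_gt0.
have DQ : Q = (Q %/ s * s)%N by rewrite divnK // dvdn_exp2l // dvdn_leq // dvdn_gcdr.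
have q_gt0 : (0 < Q %/ s)%N by move: Q_gt0; rewrite {1}DQ muln_gt0 => /andP[].
have le_qQ : (Q %/ s <= Q)%N by rewrite leq_div.
have le_kh : (kappa <= h)%N by rewrite dvdn_leq // dvdn_gcdl.
have nz_h : h%:R != 0 :> rat by rewrite Num.Theory.pnatr_eq0 -lt0n.
have nz_s : s%:R != 0 :> rat by rewrite Num.Theory.pnatr_eq0 -lt0n.
move=> DS; apply: (scalerI nz_h); rewrite scaler_nat DS.
rewrite -!scaler_nat !scalerDr !scalerA !natrB // /M_zero /M_one /M_s.
have DQr : Q%:R = (Q %/ s)%:R * s%:R :> rat by rewrite {1}DQ natrM.
have -> : h%:R * (kappa%:R * (s%:R - 1) * Q%:R / (h%:R * s%:R))
          = kappa%:R * (Q%:R - (Q %/ s)%:R) :> rat.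
  by rewrite DQr; field; rewrite ?nz_h ?nz_s.
have -> : h%:R * ((h%:R - kappa%:R) * (Q%:R - 1) / h%:R)
          = (h%:R - kappa%:R) * (Q%:R - 1) :> rat.
  by field.
have -> : h%:R * (kappa%:R * (Q%:R - s%:R) / (h%:R * s%:R))
          = kappa%:R * ((Q %/ s)%:R - 1) :> rat.
  by rewrite DQr; field; rewrite ?nz_h ?nz_s.
by rewrite [X in X + _]addrC -addrA [X in _ + X]addrC.
Qed.

Theorem corollary5p1 (p e h m : nat) (F : finFieldType) :
  let N := (p ^ e)%N in
  let Q := (p ^ m)%N in
  let s := (p ^ gcdn e m)%N in
  let C := ((N - 1) %/ (s - 1))%N in
  let kappa := gcdn h C in
  prime p -> (1 <= e)%N -> (1 <= h)%N -> (h %| N - 1)%N -> (1 <= m)%N ->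
  #|F| = Q ->
  [/\ (* the exponent 1 + kappa (s - 1) / h is an integer *)
      (h %| kappa * (s - 1))%N,
      fibre_enumerator F N h =
        'X^(1 + (kappa * (s - 1)) %/ h) + (M_zero h kappa s Q)%:P
        + (M_one h kappa Q)%:P * 'X + (M_s h kappa s Q)%:P * 'X^s,
      (#|value_set F N h|)%:R = Q%:R - M_zero h kappa s Q,
      Q%:R - M_zero h kappa s Q =
        Q%:R * (1 - kappa%:R * (s%:R - 1) / (h%:R * s%:R)) &
      forall a : nat, (1 <= a)%N ->
        (\sum_(t : F) fibre_card N h t ^ a)%N%:R =
          (1 + kappa%:R * (s%:R - 1) / h%:R) ^+ a
          + (h%:R - kappa%:R) * (Q%:R - 1) / h%:R
          + s%:R ^+ (a - 1) * (kappa%:R * (Q%:R - s%:R) / h%:R) :> rat].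
Proof.
move=> N Q s C kappa p_pr e_gt0 h_gt0 dv_h m_gt0 cardF.
have sumG V G := @sum_fibres p e h m F V G p_pr e_gt0 h_gt0 dv_h m_gt0 cardF.
(* The zero weight serves only to extract the divisibility. *)
have [dv_hk _] := sumG rat^o (fun _ => 0).
have {}sumG V G := (sumG V G).2; rewrite -/N -/Q -/s -/C -/kappa in dv_hk sumG.
have s_gt0 : (0 < s)%N by rewrite expn_gt0 prime_gt0.
have nz_h : h%:R != 0 :> rat by rewrite Num.Theory.pnatr_eq0 -lt0n.
have nz_s : s%:R != 0 :> rat by rewrite Num.Theory.pnatr_eq0 -lt0n.
split=> //.
- rewrite /fibre_enumerator (sumG _ (fun k => 'X^k)) expr0 expr1.
  by rewrite !mul_polyC alg_polyC.
- have -> : #|value_set F N h| = (\sum_(t : F) (0 < fibre_card N h t))%N.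
    rewrite -sum1_card big_mkcond; apply: eq_bigr => t _.
    suff -> : (t \in value_set F N h) = (0 < fibre_card N h t)%N by case: (0 < _)%N.
    apply/imsetP/card_gt0P => [[u _ ->] | [u]]; first by exists u; rewrite inE.
    by rewrite inE => /eqP <-; exists u.
  (* The indicator of nonempty fibres kills the [M_zero] term; what remains is 1 + M_1 + M_s = Q -
     M_0. *)
  rewrite natr_sum (sumG rat^o (fun k => (0 < k)%:R)) /= s_gt0.
  rewrite /M_zero /M_one /M_s /GRing.scale /=.
  by field; rewrite ?nz_h ?nz_s.
- by rewrite /M_zero; field; rewrite ?nz_h ?nz_s.
move=> a a_gt0; rewrite natr_sum (sumG rat^o (fun k => (k ^ a)%:R)).
have natrXa n : (n ^ a)%:R = n%:R ^+ a :> rat by rewrite natrX.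
(* Empty fibres contribute 0^a = 0 because a is positive. *)
rewrite exp0n // exp1n !natrXa natrD.
have -> : (kappa * (s - 1) %/ h)%:R = kappa%:R * (s%:R - 1) / h%:R :> rat.
  by apply: (mulIf nz_h); rewrite -natrM divnK // divfK // natrM natrB.
rewrite /M_zero /M_one /M_s /GRing.scale /= mulr0 addr0 mulr1; congr (_ + _ + _).
(* One factor s of s^a cancels the s in the denominator of [M_s]. *)
by rewrite -{1}(subnK a_gt0) exprD expr1; field; rewrite ?nz_h ?nz_s.
Qed.
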